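(* Let $d\in\mathbb N$, let $\mathcal F=\{\mathbf 1_{[0,x]} : x\in[0,1]^d\}$, and let $\mathcal G$ be the closure of $\mathcal F$ under monotone convergence, i.e. the set of all functions $g:[0,1]^d\to\mathbb R$ for which there exists a sequence $f_k\in\mathcal F$, $k\in\mathbb N$, with $f_k\uparrow g$ pointwise. Suppose that $X,Y:\mathrm{span}(\mathcal G)\to\mathbb R$ are two linear maps which satisfy the following conditions: (a) Both $X$ and $Y$ are continuous with respect to monotone convergence in $\mathcal F$, i.e. if $f_k\in\mathcal F$, $k\in\mathbb N$, and $f_k\uparrow g$ for some $g\in\mathcal G$, then $X(f_k)\to X(g)$ and $Y(f_k)\to Y(g)$. (b) $X(\mathbf 1_{[0,1]^d})=Y(\mathbf 1_{[0,1]^d})$. Then $$|X(g)-Y(g)|\le\|g\|_{\mathrm{HK}}\,\|X-Y\|_{\mathcal F}$$ for all $g\in\mathrm{span}(\mathcal G)$ (and $\|g\|_{\mathrm{HK}}<\infty$ for all such $g$). If furthermore (in addition to the previous conditions) $X$ and $Y$ are defined on $\mathcal{HK}(c)$ for some $0<c<\infty$ (as well as on $\mathrm{span}(\mathcal G)$) and are continuous with respect to uniform convergence on $\mathcal{HK}(c)$, then $$|X(h)-Y(h)|\le\|h\|_{\mathrm{HK}}\,\|X-Y\|_{\mathcal F}$$ for any $h\in\mathcal{HK}(c)$.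
   Context: For $x\in[0,1]^d$, $[0,x]=\prod_{i=1}^d[0,x_i]$. $\|X-Y\|_{\mathcal F}=\sup_{f\in\mathcal F}|X(f)-Y(f)|\in[0,\infty]$ (with $0\cdot\infty=0$). Hardy-Krause variation. For $f:[0,1]^k\to\mathbb R$ and a box $B=\prod_{i=1}^k[a_i,b_i]$ put $\Delta^{(k)}(f;B)=\sum_{j_1,\dots,j_k\in\{0,1\}}(-1)^{j_1+\cdots+j_k}f\big(b_1+j_1(a_1-b_1),\dots,b_k+j_k(a_k-b_k)\big)$. The Vitali variation is $V^{(k)}(f)=\sup_{\mathcal P}\sum_{B\in\mathcal P}|\Delta^{(k)}(f;\bar B)|$, the supremum being over all finite partitions $\mathcal P$ of $[0,1]^k$ into hyperrectangles ($\bar B$ = closure). For $h:[0,1]^d\to\mathbb R$ and $1\le i_1<\dots<i_r\le d$ let $f_{i_1,\dots,i_r}:[0,1]^r\to\mathbb R$ be the restriction of $h$ to the face $\{x\in[0,1]^d: x_j=1\text{ for }j\notin\{i_1,\dots,i_r\}\}$, identified with $[0,1]^r$ in the natural way. Then $\|h\|_{\mathrm{HK}}=\sum_{r=1}^d\sum_{1\le i_1<\dots<i_r\le d}V^{(r)}(f_{i_1,\dots,i_r})$. $\mathcal{HK}(c)$ is the set of all $h:[0,1]^d\to\mathbb R$ with $\|h\|_{\mathrm{HK}}<c$ and $\|h\|_\infty\le c$. *)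

(* Defs.v *)
From HB Require Import structures.
From mathcomp Require Import all_boot all_order all_algebra interval_inference.
From mathcomp Require Import all_classical all_reals all_analysis.

Set Implicit Arguments.
Unset Strict Implicit.
Unset Printing Implicit Defensive.

Import Order.TTheory GRing.Theory Num.Theory.
Import numFieldNormedType.Exports.

Local Open Scope classical_set_scope.
Local Open Scope ring_scope.

(* [0,1]^k as a type, so that functions on the cube carry no values outside
   it and equality of such functions is equality on the cube. *)
Definition cube (R : realType) (k : nat) := 'I_k -> {i01 R}.

(* The hyperrectangle with sides from [rlo i] to [rhi i]; [rlo_in i] (resp.
   [rhi_in i]) says whether the left (resp. right) endpoint belongs to the
   i-th side.  When it is nonempty, its closure is the product of the closed
   intervals from [rlo i] to [rhi i]. *)
Record hrect (R : realType) (k : nat) := HRect {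
  rlo : cube R k;
  rhi : cube R k;
  rlo_in : 'I_k -> bool;
  rhi_in : 'I_k -> bool }.

(* [BSide true] is the closed left and the open right bound. *)
Definition hrect_set (R : realType) (k : nat) (B : hrect R k) : set (cube R k) :=
  [set x | forall i, (x i)%:num \in
     Interval (BSide (rlo_in B i) (rlo B i)%:num)
              (BSide (~~ rhi_in B i) (rhi B i)%:num)].

Definition box_delta (R : realType) (k : nat) (f : cube R k -> R)
    (a b : cube R k) : R :=
  \sum_(j : {ffun 'I_k -> bool})
     (-1) ^+ (\sum_(i < k) j i)%N * f (fun i => if j i then a i else b i).

Definition vitali_variation (R : realType) (k : nat) (f : cube R k -> R) : \bar R :=
  ereal_sup [set v : \bar R | exists n (P : 'I_n -> hrect R k),
    partition [set: 'I_n] (fun m => hrect_set (P m)) [set: cube R k] /\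
    v = (\sum_(m < n) `|box_delta f (rlo (P m)) (rhi (P m))|)%:E].

(* The restriction of h to the face spanned by the coordinates s 0, s 1, ...,
   all other coordinates being equal to 1. *)
Definition face (R : realType) (d r : nat) (h : cube R d -> R)
    (s : 'I_r -> 'I_d) : cube R r -> R :=
  fun y => h (fun j => if [pick i | s i == j] is Some i then y i else 1%:i01).

Definition increasing_ord (r d : nat) (s : {ffun 'I_r -> 'I_d}) : bool :=
  [forall i1 : 'I_r, forall i2 : 'I_r, (i1 < i2)%N ==> (s i1 < s i2)%N].

Definition hk_norm (R : realType) (d : nat) (h : cube R d -> R) : \bar R :=
  (\sum_(1 <= r < d.+1) \sum_(s : {ffun 'I_r -> 'I_d} | increasing_ord s)
     vitali_variation (face h s))%E.

Definition sup_norm (R : realType) (d : nat) (h : cube R d -> R) : \bar R :=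
  ereal_sup [set `|h x|%:E | x in [set: cube R d]].

Definition hk_class (R : realType) (d : nat) (c : R) : set (cube R d -> R) :=
  [set h | (hk_norm h < c%:E)%E /\ (sup_norm h <= c%:E)%E].

Definition box0 (R : realType) (d : nat) (x : cube R d) : set (cube R d) :=
  [set y | forall i, (y i)%:num \in `[0, (x i)%:num]].

Definition box_indicators (R : realType) (d : nat) : set (cube R d -> R) :=
  [set (\1_(box0 x) : cube R d -> R) | x in [set: cube R d]].

Definition increases_to (R : realType) (T : Type) (f_ : nat -> T -> R)
    (g : T -> R) : Prop :=
  forall y, nondecreasing_seq (fun k => f_ k y) /\
            (fun k => f_ k y) @ \oo --> g y.

Definition monotone_closure (R : realType) (T : Type) (F : set (T -> R)) :
    set (T -> R) :=
  [set g | exists f_ : nat -> T -> R, (forall k, F (f_ k)) /\ increases_to f_ g].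

Definition lin_span (R : realType) (T : Type) (G : set (T -> R)) : set (T -> R) :=
  [set g | exists n (a : 'I_n -> R) (f : 'I_n -> T -> R),
     (forall i, G (f i)) /\ g = \sum_(i < n) a i *: f i].

(* Functionals on a set D of functions are total maps of which only the values
   on D matter. *)
Definition linear_on (R : realType) (T : Type) (D : set (T -> R))
    (X : (T -> R) -> R) : Prop :=
  forall (a : R) (u v : T -> R), D u -> D v -> X (a *: u + v) = a * X u + X v.

Definition monotone_continuous (R : realType) (T : Type) (F : set (T -> R))
    (X : (T -> R) -> R) : Prop :=
  forall (f_ : nat -> T -> R) (g : T -> R),
    (forall k, F (f_ k)) -> monotone_closure F g -> increases_to f_ g ->
    (fun k => X (f_ k)) @ \oo --> X g.

Definition continuous_wrt_uniform (R : realType) (d : nat)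
    (D : set (cube R d -> R)) (X : (cube R d -> R) -> R) : Prop :=
  forall (h_ : nat -> cube R d -> R) (h : cube R d -> R),
    (forall k, D (h_ k)) -> D h -> {uniform, h_ @ \oo --> h} ->
    (fun k => X (h_ k)) @ \oo --> X h.

Definition sup_dist (R : realType) (T : Type) (F : set (T -> R))
    (X Y : (T -> R) -> R) : \bar R :=
  ereal_sup [set `|X f - Y f|%:E | f in F].

(* Main.v *)
Require Import Defs.
From HB Require Import structures.
From mathcomp Require Import all_boot all_order all_algebra interval_inference.
From mathcomp Require Import all_classical all_reals all_analysis.
From mathcomp Require Import ring lra zify.

Set Implicit Arguments.
Unset Strict Implicit.
Unset Printing Implicit Defensive.

Import Order.TTheory GRing.Theory Num.Theory.
Import numFieldNormedType.Exports.

Local Open Scope classical_set_scope.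
Local Open Scope ring_scope.

(** Why the inequality holds.

    Write D for the supremum of |X f - Y f| over indicators of closed boxes
    anchored at the origin.  By continuity along increasing sequences the bound
    |X f - Y f| <= D persists for the indicator of any product of nonempty
    intervals [0, q] or [0, q[ ([closure_dist_le], [prod_indic_closure]), and these
    indicators are exactly the elements of the monotone closure
    ([closure_prod_indic]).  So it suffices to write a function g of the span as
    a combination of such indicators in which the total mass of the
    coefficients, apart from that of the constant 1, is at most the
    Hardy-Krause norm of g; the constant costs nothing because X and Y agree on
    it.

    Such a representation comes from two identities.  First, inclusion-exclusion
    anchored at the corner (1, ..., 1) writes h x as h (1, ..., 1) plus the sum,
    over all faces through that corner, of the signed corner differences of h on
    the box [x, 1] of the face ([face_expansion]).  Secondly, the corner
    difference of a box is the sum of those of the cells of any grid subdividing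
    it ([alt_sum_grid]).  If g depends on each coordinate t only through a
    monotone index kappa t in {0, ..., M}, combining the two gives a sum over
    cells, where the cell k contributes to g x exactly when kappa x <= k, that
    is, when x lies in a product of anchored intervals ([step_expansion]).  The
    coefficients of one face are the corner differences over the cells of a
    grid, so their absolute values sum to at most the Vitali variation of that
    face ([step_dist_le]).  An element of the span depends on each coordinate
    only through the number of intervals in its representation that the
    coordinate has left, hence is of this form ([span_step_index]).

    Estimates of the Vitali variation all rest on one remark: partitions into
    boxes may be replaced by families of boxes with pairwise disjoint interiors
    ([partition_nonoverlapping], [nonoverlapping_sum_le_vitali]), and the latter
    are stable under coordinatewise monotone maps.  Thus composing with a
    monotone map that fixes 1 does not increase the Hardy-Krause norm
    ([hk_norm_comp_le]), and step functions have finite variation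
    ([vitali_variation_step_lty]).

    For h of finite Hardy-Krause norm, let W t be the total variation of the
    faces of h over the slabs where one coordinate is at most t.  A change of
    one coordinate from t to t' changes h by at most |W t - W t'|
    ([update_dist_le]).  Cutting [0, 1] into the level sets of W at scale e
    therefore yields a monotone step map pi of the interval such that
    h (pi x_1, ..., pi x_d) is uniformly within d e of h
    ([hk_step_approximation]); as its Hardy-Krause and supremum norms do not
    exceed those of h, it stays in the class HK(c).  The bound for step
    functions passes to the limit. *)

(** * Alternating sums over the corners of a box *)

(** The corner difference [box_delta], for an arbitrary set [T] of coordinate
    values: the combinatorics below takes place on grids of natural numbers and
    is carried to the unit interval by [alt_sum_comp]. *)
Definition alt_sum (R : pzRingType) (I : finType) (T : Type) (f : (I -> T) -> R)
    (a b : I -> T) : R :=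
  \sum_(j : {ffun I -> bool})
     (-1) ^+ (\sum_i j i)%N * f (fun i => if j i then a i else b i).

Lemma alt_sum_comp (R : pzRingType) (I : finType) (T T' : Type)
    (phi : I -> T -> T') (f : (I -> T') -> R) (a b : I -> T) :
  alt_sum f (fun i => phi i (a i)) (fun i => phi i (b i)) =
  alt_sum (fun x => f (fun i => phi i (x i))) a b.
Proof.
apply: eq_bigr => j _; congr (_ * f _); apply/funext => i.
by case: (j i).
Qed.

(** The corner difference is the integral of [F] against the product over i of
    the signed measures (mass at [b i]) - (mass at [a i]); as a product of
    one-dimensional factors it can be treated one coordinate at a time. *)
Lemma alt_sum_point_masses (R : comPzRingType) (I : finType) (M : nat)
    (F : (I -> nat) -> R) (a b : I -> nat) :
    (forall i, (a i <= M)%N) -> (forall i, (b i <= M)%N) ->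
  alt_sum F a b =
  \sum_(y : {ffun I -> 'I_M.+1})
     F (fun i => y i) * \prod_i ((b i == y i)%:R - (a i == y i)%:R).
Proof.
move=> aM bM; pose c (e : bool) i := if e then a i else b i.
have cM e i : (c e i < M.+1)%N by rewrite ltnS /c; case: e.
under [RHS]eq_bigr => y _.
  have -> : \prod_i ((b i == y i)%:R - (a i == y i)%:R) =
      \prod_i \sum_(e : bool) (-1) ^+ e * (c e i == y i)%:R :> R.
    apply: eq_bigr => i _.
    by rewrite big_bool /= expr1 expr0 mul1r mulN1r addrC.
  rewrite bigA_distr_bigA big_distrr /=.
  under eq_bigr => j _ do rewrite big_split /= prodrXr mulrA [F _ * _]mulrC.
  over.
rewrite exchange_big /=; apply: eq_bigr => j _.
(* Only the grid point that is the corner [j] itself carries mass. *)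
pose y0 := [ffun i => Ordinal (cM (j i) i)].
rewrite (bigD1 y0) //= [X in _ + X]big1 ?addr0.
  rewrite [X in _ = _ * X]big1 ?mulr1; last by move=> i _; rewrite ffunE eqxx.
  by congr (_ * F _); apply/funext => i; rewrite ffunE.
move=> y yy0; have [i yi] : exists i, c (j i) i != y i :> nat.
  apply/existsP; apply: contraR yy0 => /existsPn/= yc.
  by apply/eqP/ffunP => i; rewrite ffunE; apply/val_inj/esym/eqP/negPn/yc.
by rewrite [\prod_i _](bigD1 i) //= (negbTE yi) mul0r mulr0.
Qed.

(** In each coordinate (mass at [b i]) - (mass at [a i]) telescopes into the
    steps from [k] to [k.+1] with [a i <= k < b i]; distributing the product over
    these sums gives the additivity of corner differences over the cells of a
    grid. *)
Lemma alt_sum_grid (R : comPzRingType) (I : finType) (M : nat)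
    (F : (I -> nat) -> R) (a b : I -> nat) :
    (forall i, (a i <= b i)%N) -> (forall i, (b i <= M)%N) ->
  alt_sum F a b =
  \sum_(k : {ffun I -> 'I_M} | [forall i, (a i <= k i < b i)%N])
     alt_sum F (fun i => k i) (fun i => (k i).+1).
Proof.
move=> ab bM; have aM i : (a i <= M)%N := leq_trans (ab i) (bM i).
rewrite (alt_sum_point_masses _ aM bM).
under [RHS]eq_bigr => k _.
  rewrite (@alt_sum_point_masses _ _ M); last 2 first.
  - by move=> i; apply: ltnW.
  - by move=> i.
  over.
rewrite exchange_big /=; apply: eq_bigr => y _; rewrite -big_distrr /=.
congr (_ * _); transitivity (\prod_i \sum_(k : 'I_M | (a i <= k < b i)%N)
    ((k.+1 == y i :> nat)%:R - (k == y i :> nat)%:R) : R).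
  apply: eq_bigr => i _.
  rewrite -(telescope_sumr (fun k => (k == y i :> nat)%:R)) //.
  rewrite (big_nat_widen _ _ _ _ _ (bM i)) big_nat_cond.
  rewrite (big_nat_widenl _ 0) // big_mkord; apply: eq_bigl => k /=.
  by rewrite ltn_ord; case: (a i <= k)%N; rewrite ?andbT ?andbF.
rewrite bigA_distr_big_dep; apply: eq_bigl => k.
by apply/familyP/forallP => h i; have := h i; rewrite ?inE.
Qed.

(** Disjointness of the interiors of two boxes, degenerate ones included.  It is
    phrased by weak inequalities between endpoints, and not by points, so that
    monotone maps preserve it even when they are not surjective. *)
Definition nonoverlapping (I : finType) (d : Order.disp_t) (T : orderType d)
    (a b a' b' : I -> T) : bool :=
  [exists i, [|| (b i <= a' i)%O, (b' i <= a i)%O, (b i <= a i)%O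
               | (b' i <= a' i)%O]].

Lemma nonoverlapping_homo (I : finType) (d d' : Order.disp_t) (T : orderType d)
    (T' : orderType d') (phi : I -> T -> T') (a b a' b' : I -> T) :
    (forall i, {homo phi i : x y / (x <= y)%O}) ->
  nonoverlapping a b a' b' ->
  nonoverlapping (fun i => phi i (a i)) (fun i => phi i (b i))
            (fun i => phi i (a' i)) (fun i => phi i (b' i)).
Proof.
move=> hphi /existsP[i sep]; apply/existsP; exists i.
by case/or4P: sep => /hphi ->; rewrite ?orbT.
Qed.

(** Each box splits into unit cells, and no cell lies in two of the boxes. *)
Lemma sum_alt_sum_le_grid (R : numDomainType) (I J : finType) (M : nat)
    (F : (I -> nat) -> R) (a b : J -> I -> nat) :
    (forall j i, (a j i <= b j i)%N) -> (forall j i, (b j i <= M)%N) ->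
    (forall j j', j != j' -> nonoverlapping (a j) (b j) (a j') (b j')) ->
  \sum_j `|alt_sum F (a j) (b j)| <=
  \sum_(k : {ffun I -> 'I_M}) `|alt_sum F (fun i => k i) (fun i => (k i).+1)|.
Proof.
move=> ab bM sep; pose G (k : {ffun I -> 'I_M}) :=
  `|alt_sum F (fun i => k i) (fun i => (k i).+1)|.
pose Q j (k : {ffun I -> 'I_M}) := [forall i, (a j i <= k i < b j i)%N].
apply: (@le_trans _ _ (\sum_j \sum_(k | Q j k) G k)).
  by apply: ler_sum => j _; rewrite (alt_sum_grid _ (ab j) (bM j)) ler_norm_sum.
rewrite (exchange_big_dep xpredT) //=; apply: ler_sum => k _; rewrite -/(G k).
(* At most one box of the family contains the cell [k]. *)
have [j Qj|noQ] := pickP (Q^~ k); last by rewrite big_pred0 /G.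
rewrite (bigD1 j) //= big1 ?addr0 // => j' /andP[Qj' j'j].
have /existsP[i] := sep _ _ j'j.
have /andP[] := forallP Qj i; have /andP[] := forallP Qj' i.
by rewrite !leEnat; lia.
Qed.

Definition update (I : eqType) (T : Type) (x : I -> T) (l : I) (c : T) : I -> T :=
  fun m => if m == l then c else x m.

(** In the corner sums of the two boxes on the right, the corners with value [c]
    in coordinate [l] occur once with each sign and cancel. *)
Lemma alt_sum_split (R : pzRingType) (I : finType) (T : Type) (f : (I -> T) -> R)
    (a b : I -> T) (l : I) (c : T) :
  alt_sum f a b = alt_sum f a (update b l c) + alt_sum f (update a l c) b.
Proof.
pose G (a b : I -> T) (j : {ffun I -> bool}) :=
  (-1) ^+ (\sum_i j i)%N * f (fun i => if j i then a i else b i).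
rewrite /alt_sum -!/(G _ _ _) !(bigID (fun j : {ffun I -> bool} => j l) xpredT) /=.
have -> : \sum_(j : {ffun I -> bool} | j l) G a (update b l c) j =
    \sum_(j : {ffun I -> bool} | j l) G a b j.
  apply: eq_bigr => j jl; congr (_ * f _); apply/funext => i; rewrite /update.
  by have [->|] := eqVneq i l; rewrite ?jl.
have -> : \sum_(j : {ffun I -> bool} | ~~ j l) G (update a l c) b j =
    \sum_(j : {ffun I -> bool} | ~~ j l) G a b j.
  apply: eq_bigr => j jl; congr (_ * f _); apply/funext => i; rewrite /update.
  by have [->|] := eqVneq i l; rewrite ?(negbTE jl).
rewrite -!addrA; congr (_ + _); rewrite addrA -[LHS]add0r; congr (_ + _).
(* Exchanging the two ends of side [l] reverses the sign of a corner. *)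
pose flip (j : {ffun I -> bool}) := [ffun m => (m == l) (+) j m].
have flipK : involutive flip.
  by move=> j; apply/ffunP => m; rewrite !ffunE addbA addbb.
rewrite [X in _ = _ + X](reindex_inj (inv_inj flipK)) /=.
under [X in _ = _ + X]eq_bigl => j do rewrite ffunE eqxx addTb.
rewrite -big_split big1 //= => j jl; rewrite /G.
have -> : (\sum_i flip j i = 1 + \sum_i j i)%N.
  rewrite (bigD1 l) //= [X in (1 + X)%N](bigD1 l) //= ffunE eqxx (negbTE jl) add0n.
  by congr addn; apply: eq_bigr => i /negbTE il; rewrite ffunE il.
rewrite exprD expr1 -mulrA mulN1r; apply/eqP; rewrite addr_eq0 opprK; apply/eqP.
congr (_ * f _); apply/funext => i; rewrite ffunE /update.
by have [->|] := eqVneq i l; rewrite ?(negbTE jl).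
Qed.

(** * The unit interval: finite grids and step maps *)

(** The endpoints are named so that all occurrences are syntactically the same
    element of the subtype. *)
Definition zero01 (R : realType) : {i01 R} := 0%:i01.
Definition one01 (R : realType) : {i01 R} := 1%:i01.
Arguments zero01 {R}.
Arguments one01 {R}.

Lemma i01_ge0 (R : realType) (x : {i01 R}) : (zero01 <= x)%O.
Proof. by rewrite -num_le; exact: ge0. Qed.

Lemma i01_le1 (R : realType) (x : {i01 R}) : (x <= one01)%O.
Proof. by rewrite -num_le; exact: le1. Qed.

Lemma grid_through (R : realType) (l : seq {i01 R}) :
  exists (N : nat) (t : nat -> {i01 R}),
    [/\ t 0%N = zero01, t N = one01,
        forall i j, (i < j <= N)%N -> (t i < t j)%O &
        forall x, x \in l -> exists2 k, (k <= N)%N & t k = x].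
Proof.
pose L : seq {i01 R} := sort <=%O (undup (zero01 :: one01 :: l)).
have L_lt : sorted <%O L by rewrite sort_lt_sorted undup_uniq.
have memL x : (x \in L) = (x \in [:: zero01, one01 & l]).
  by rewrite mem_sort mem_undup.
have L0 : (0 < size L)%N.
  by rewrite (leq_ltn_trans (leq0n (index zero01 L))) // index_mem memL inE eqxx.
have t_lt i j : (i < j <= (size L).-1)%N -> (nth one01 L i < nth one01 L j)%O.
  move=> /andP[ij jN]; have jL : (j < size L)%N by lia.
  have iL : (i < size L)%N by lia.
  by rewrite lt_sorted_ltn_nth // inE.
have t_le i j : (i <= j <= (size L).-1)%N -> (nth one01 L i <= nth one01 L j)%O.
  by move=> /andP[]; rewrite leq_eqVlt => /orP[/eqP->//|ij jN]; apply/ltW/t_lt/andP.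
have t_surj x : x \in L -> exists2 k, (k <= (size L).-1)%N & nth one01 L k = x.
  move=> xL; exists (index x L); last by rewrite nth_index.
  by rewrite -ltnS prednK // index_mem.
exists (size L).-1, (nth one01 L); split=> //.
- have [|k kN e0] := t_surj zero01; first by rewrite memL inE eqxx.
  by apply/le_anti; rewrite i01_ge0 andbT -[leRHS]e0 t_le.
- have [|k kN e1] := t_surj one01; first by rewrite memL !inE eqxx orbT.
  by apply/le_anti; rewrite i01_le1 /= -[leLHS]e1 t_le // kN /=.
- by move=> x xl; apply: t_surj; rewrite memL !inE xl !orbT.
Qed.

(** Choosing [p k] in the level set of index [k] may fail where [kappa] skips
    [k]; there [p] keeps its previous value, which preserves monotonicity.  The
    value 1 is chosen on the last level set, because step maps must fix 1 in
    order to be compatible with the faces of the cube. *)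
Lemma step_points (R : realType) (kappa : {i01 R} -> nat) :
    {homo kappa : x y / (x <= y)%O >-> (x <= y)%N} -> kappa zero01 = 0%N ->
  exists p : nat -> {i01 R},
    [/\ {homo p : i j / (i <= j)%N >-> (i <= j)%O}, p (kappa one01) = one01 &
        forall x, kappa (p (kappa x)) = kappa x].
Proof.
move=> kappa_homo kappa0.
pose rep k : {i01 R} :=
  if k == kappa one01 then one01 else xget zero01 [set x | kappa x = k].
have kappa_rep x : kappa (rep (kappa x)) = kappa x.
  rewrite /rep; case: eqP => [->//|_].
  by case: xgetP => [y _ //|/(_ x)/(_ erefl)].
pose fix p k : {i01 R} :=
  if k is k'.+1 then if `[< exists x, kappa x = k >] then rep k else p k'
  else rep 0%N.
have pE x : p (kappa x) = rep (kappa x).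
  case E: (kappa x) => [//|k] /=.
  by case: asboolP => // -[]; exists x.
have kappa_p k : (kappa (p k) <= k)%N.
  elim: k => [|k IH] /=; first by rewrite -kappa0 kappa_rep.
  by case: asboolP => [[x <-]|_]; [rewrite kappa_rep|exact: leqW].
exists p; split=> [||x]; last by rewrite pE.
- apply: homo_leq => // [|k]; first exact: le_trans.
  rewrite /=; case: asboolP => // -[x xk].
  have [//|/ltW/kappa_homo] := leP (p k) (rep k.+1).
  by rewrite -xk kappa_rep xk => /(leq_trans)/(_ (kappa_p k)); rewrite ltnn.
- by rewrite pE /rep eqxx.
Qed.

Section levels.
Variables (R : realType) (w : {i01 R} -> R) (e : R).
Hypothesis w_homo : {homo w : t t' / (t <= t')%O >-> (t <= t')}.
Hypothesis e0 : 0 < e.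

Definition level (t : {i01 R}) : nat := Num.trunc ((w t - w zero01) / e).

Lemma level_homo : {homo level : t t' / (t <= t')%O >-> (t <= t')%N}.
Proof.
move=> t t' tt'; apply: le_truncn; rewrite ler_pM2r ?invr_gt0 // lerD2r.
exact: w_homo.
Qed.

Lemma level_zero : level zero01 = 0%N.
Proof. by rewrite /level subrr mul0r truncn0. Qed.

(** At points of equal index, the values of [w - w 0] lie between the same two
    consecutive multiples of [e]. *)
Lemma level_dist t t' : level t = level t' -> `|w t - w t'| <= e.
Proof.
move=> ltt'.
have w_itv u : (level u)%:R * e <= w u - w zero01 < (level u).+1%:R * e.
  rewrite -ler_pdivlMr // -ltr_pdivrMr //; apply: truncn_itv.
  by rewrite divr_ge0 ?(ltW e0) // subr_ge0; exact/w_homo/i01_ge0.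
have := w_itv t; have := w_itv t'; rewrite ltt' -natr1 mulrDl mul1r.
move=> /andP[t'lo t'hi] /andP[tlo thi].
by rewrite ler_norml; apply/andP; split; lra.
Qed.

End levels.

(** * Vitali variation and non-overlapping families of boxes *)

(** The cells of a grid with strictly increasing points form a partition of the
    cube once they are taken open on the left and closed on the right, with the
    left end added to the first one. *)
Lemma grid_sum_le_vitali (R : realType) (r N : nat) (t : nat -> {i01 R})
    (f : cube R r -> R) :
    t 0%N = zero01 -> t N = one01 ->
    (forall i j, (i < j <= N)%N -> (t i < t j)%O) ->
  ((\sum_(k : {ffun 'I_r -> 'I_N})
      `|alt_sum f (fun i => t (k i)) (fun i => t (k i).+1)|)%:E
    <= vitali_variation f)%E.
Proof.
move=> t0 tN t_lt.
have t_le i j : (i <= j <= N)%N -> (t i <= t j)%O.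
  by move=> /andP[]; rewrite leq_eqVlt => /orP[/eqP->//|ij jN]; apply/ltW/t_lt/andP.
have N0 : (0 < N)%N.
  rewrite lt0n; apply/negP => /eqP N0; have := tN; rewrite {1}N0 t0.
  by move=> /eqP; rewrite lt_eqF // -num_lt /=.
pose cell (k : {ffun 'I_r -> 'I_N}) : hrect R r :=
  HRect (fun i => t (k i)) (fun i => t (k i).+1) (fun i => k i == 0%N :> nat)
        (fun=> true).
have cellP k x : hrect_set (cell k) x <->
    forall i, (x i <= t (k i).+1)%O /\ (k i != 0%N :> nat -> (t (k i) < x i)%O).
  split=> + i => /(_ i); rewrite /= itv_boundlr /=;
    have [k0|k0] := eqVneq (k i : nat) 0%N; rewrite !bnd_simp /=.
  - by move=> /andP[_ hi]; split.
  - by move=> /andP[lo hi]; split.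
  - by move=> [hi _]; rewrite [X in _ && X]hi andbT k0 t0; exact: i01_ge0.
  - by move=> [hi /(_ isT) lo]; apply/andP; split.
apply: ereal_sup_ubound; exists #|{ffun 'I_r -> 'I_N}|, (cell \o enum_val).
split; last first.
  by congr (_%:E); rewrite (reindex (@enum_val _ {ffun 'I_r -> 'I_N})) //=;
    exact/onW_bij/enum_val_bij.
split.
- apply/seteqP; split=> // x _.
  (* The cell of [x] is found from the first grid point not below [x i]. *)
  have ex i : exists k, (x i <= t k.+1)%O.
    by exists N.-1; rewrite prednK // tN i01_le1.
  have kN i : (ex_minn (ex i) < N)%N.
    case: ex_minnP => k _ /(_ N.-1); rewrite prednK // tN i01_le1 => /(_ isT).
    by lia.
  exists (enum_rank [ffun i => Ordinal (kN i)]) => //=.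
  rewrite enum_rankK; apply/cellP => i; rewrite ffunE /=.
  case: ex_minnP => k xk kmin; split=> // k0; rewrite ltNge; apply/negP => xk'.
  by have := kmin k.-1; rewrite prednK ?lt0n // => /(_ xk'); lia.
- move=> m m' _ _ /= [x [/cellP xm /cellP xm']].
  apply/enum_val_inj/ffunP => i; apply/val_inj/eqP/negPn/negP => /= mm'.
  wlog lt_mm' : m m' xm xm' mm' / (enum_val m i < enum_val m' i)%N.
    move=> W; have /orP[] : (enum_val m i < enum_val m' i)%N ||
      (enum_val m' i < enum_val m i)%N by rewrite -neq_ltn.
    - exact: W.
    - by apply: W => //; rewrite eq_sym.
  have [xt _] := xm i; have [_ tx] := xm' i.
  have m'0 : (enum_val m' i != 0 :> nat)%N by lia.
  have := lt_le_trans (tx m'0) xt; rewrite ltNge t_le // lt_mm' /=.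
  exact: ltnW.
- move=> m _; exists (fun i => t (enum_val m i).+1); apply/cellP => i; split=> // _.
  by apply: t_lt; rewrite ltnSn /=.
Qed.

(** A non-overlapping family need not extend to a partition in an evident way,
    but the grid through all its corners is a partition, and refining can only
    increase the sum of the absolute corner differences. *)
Lemma nonoverlapping_sum_le_vitali (R : realType) (r : nat) (J : finType)
    (f : cube R r -> R) (a b : J -> cube R r) :
    (forall j i, (a j i <= b j i)%O) ->
    (forall j j', j != j' -> nonoverlapping (a j) (b j) (a j') (b j')) ->
  ((\sum_j `|box_delta f (a j) (b j)|)%:E <= vitali_variation f)%E.
Proof.
move=> ab sep.
pose l := [seq a p.1 p.2 | p <- enum {: J * 'I_r}]
       ++ [seq b p.1 p.2 | p <- enum {: J * 'I_r}].
have [N [t [t0 tN t_lt t_onto]]] := grid_through l.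
apply: le_trans (grid_sum_le_vitali f t0 tN t_lt); rewrite lee_fin.
have t_lt_le i j : (i <= N)%N -> (t i <= t j)%O -> (i <= j)%N.
  by move=> iN; apply: contraTT; rewrite -ltnNge -ltNge => ji; rewrite t_lt // ji.
have idx_a j i : {k : nat | (k <= N)%N & t k = a j i}.
  apply: cid2; apply: t_onto; rewrite mem_cat; apply/orP; left.
  by apply/mapP; exists (j, i); rewrite ?mem_enum.
have idx_b j i : {k : nat | (k <= N)%N & t k = b j i}.
  apply: cid2; apply: t_onto; rewrite mem_cat; apply/orP; right.
  by apply/mapP; exists (j, i); rewrite ?mem_enum.
pose A j i := s2val (idx_a j i); pose B j i := s2val (idx_b j i).
have AN j i : (A j i <= N)%N := s2valP (idx_a j i).
have BN j i : (B j i <= N)%N := s2valP (idx_b j i).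
have tA j i : t (A j i) = a j i := s2valP' (idx_a j i).
have tB j i : t (B j i) = b j i := s2valP' (idx_b j i).
pose F (k : 'I_r -> nat) := f (fun i => t (k i)).
have deltaE j : box_delta f (a j) (b j) = alt_sum F (A j) (B j).
  have -> : a j = fun i => t (A j i) by apply/funext.
  have -> : b j = fun i => t (B j i) by apply/funext.
  exact: (alt_sum_comp (fun=> t)).
under eq_bigr do rewrite deltaE.
under [leRHS]eq_bigr do rewrite (alt_sum_comp (fun=> t)).
apply: sum_alt_sum_le_grid => // [j i|j j' /sep].
  by apply: t_lt_le => //; rewrite tA tB.
move=> /existsP[i]; rewrite -!tA -!tB => sep_i; apply/existsP; exists i.
by case/or4P: sep_i => /t_lt_le le_i; rewrite leEnat le_i ?orbT.
Qed.

(** If two boxes of a partition overlapped, the midpoint of their common part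
    would belong to both, whichever of their endpoints are included. *)
Lemma partition_nonoverlapping (R : realType) (r n : nat) (P : 'I_n -> hrect R r) :
    partition [set: 'I_n] (fun m => hrect_set (P m)) [set: cube R r] ->
  (forall m i, (rlo (P m) i <= rhi (P m) i)%O) /\
  (forall m m', m != m' ->
     nonoverlapping (rlo (P m)) (rhi (P m)) (rlo (P m')) (rhi (P m'))).
Proof.
move=> [_ tri ne]; split=> [m i|m m' mm'].
  have [x xm] := ne m I; have := xm i; rewrite itv_boundlr => /andP[lo hi].
  have lo' : (rlo (P m) i <= x i)%O.
    by move: lo; case: (rlo_in _ _); rewrite bnd_simp // => /ltW.
  by apply: le_trans lo' _; move: hi; case: (rhi_in _ _); rewrite bnd_simp // => /ltW.
apply: contraNT mm' => /existsPn nsep; apply/eqP/tri => //.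
pose a i := Order.max (rlo (P m) i) (rlo (P m') i).
pose b i := Order.min (rhi (P m) i) (rhi (P m') i).
have ab i : (a i < b i)%O.
  have := nsep i; rewrite !negb_or -!ltNge => /and4P[h1 h2 h3 h4].
  by rewrite lt_min !gt_max h1 h2 h3 h4.
(* The common part of two overlapping boxes has sides from [a i] to [b i]. *)
have mid01 i : 0 <= ((a i)%:num + (b i)%:num) / 2 :> R /\
    ((a i)%:num + (b i)%:num) / 2 <= 1 :> R.
  have := [elaborate ge0 (a i)]; have := [elaborate ge0 (b i)].
  have := [elaborate le1 (a i)]; have := [elaborate le1 (b i)].
  lra.
pose x i : {i01 R} := Itv01 (mid01 i).1 (mid01 i).2.
have abx i : (a i < x i)%O /\ (x i < b i)%O.
  by have := ab i; rewrite -!num_lt /=; lra.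
have in_open q : (forall i, (rlo (P q) i < x i)%O /\ (x i < rhi (P q) i)%O) ->
    hrect_set (P q) x.
  move=> h i; have [lo hi] := h i; rewrite itv_boundlr; apply/andP; split.
    by case: (rlo_in _ _); rewrite bnd_simp; [apply: ltW|].
  by case: (rhi_in _ _); rewrite bnd_simp; [apply: ltW|].
exists x; split; apply: in_open => i; have [lo hi] := abx i.
- split; first by apply: le_lt_trans lo; rewrite le_max lexx.
  by apply: lt_le_trans hi _; rewrite ge_min lexx.
- split; first by apply: le_lt_trans lo; rewrite le_max lexx orbT.
  by apply: lt_le_trans hi _; rewrite ge_min lexx orbT.
Qed.

(** Since [p] is only weakly monotone the cells may be degenerate and need not
    cover the cube, so they do not form a partition, but they do not overlap. *)
Lemma monotone_grid_le_vitali (R : realType) (r M : nat) (p : nat -> {i01 R})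
    (f : cube R r -> R) :
    {homo p : i j / (i <= j)%N >-> (i <= j)%O} ->
  ((\sum_(k : {ffun 'I_r -> 'I_M})
      `|box_delta f (fun i => p (k i)) (fun i => p (k i).+1)|)%:E
    <= vitali_variation f)%E.
Proof.
move=> p_homo.
apply: (nonoverlapping_sum_le_vitali f (a := fun (k : {ffun 'I_r -> 'I_M}) i => p (k i))
  (b := fun k i => p (k i).+1)) => [k i|k k' kk'].
  exact/p_homo/leqnSn.
apply: (@nonoverlapping_homo 'I_r _ _ nat {i01 R} (fun=> p)) => //.
apply/existsP; have [i ki] : exists i, k i != k' i :> nat.
  apply/existsP; apply: contraNT kk' => /existsPn kk'.
  by apply/eqP/ffunP => i; apply/val_inj/eqP/negPn/kk'.
by exists i; move: ki; rewrite neq_ltn !leEnat => /orP[] ->; rewrite ?orbT.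
Qed.

Lemma vitali_variation_le (R : realType) (r : nat) (f : cube R r -> R) (v : \bar R) :
  (forall (n : nat) (a b : 'I_n -> cube R r),
     (forall j i, (a j i <= b j i)%O) ->
     (forall j j', j != j' -> nonoverlapping (a j) (b j) (a j') (b j')) ->
     ((\sum_j `|box_delta f (a j) (b j)|)%:E <= v)%E) ->
  (vitali_variation f <= v)%E.
Proof.
move=> fv; apply: ge_ereal_sup => _ [n [P [partP ->]]].
by have [ab sep] := partition_nonoverlapping partP; apply: fv.
Qed.

Lemma vitali_variation_ge0 (R : realType) (r : nat) (f : cube R r -> R) :
  (0 <= vitali_variation f)%E.
Proof.
apply: le_trans (nonoverlapping_sum_le_vitali f
  (a := fun (_ : 'I_0) _ => zero01) (b := fun _ _ => zero01) _ _).
- by rewrite lee_fin; apply: sumr_ge0.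
- by case.
- by case.
Qed.

(** The image of a non-overlapping family under a monotone map is
    non-overlapping. *)
Lemma vitali_variation_comp_le (R : realType) (r : nat)
    (phi : 'I_r -> {i01 R} -> {i01 R}) (f : cube R r -> R) :
    (forall i, {homo phi i : x y / (x <= y)%O}) ->
  (vitali_variation (fun x => f (fun i => phi i (x i))) <= vitali_variation f)%E.
Proof.
move=> phi_homo; apply: vitali_variation_le => n a b ab sep.
under eq_bigr do rewrite -[box_delta _ _ _](alt_sum_comp phi f).
apply: nonoverlapping_sum_le_vitali => [j i|j j' /sep]; first exact/phi_homo/ab.
exact: (@nonoverlapping_homo _ _ _ {i01 R} {i01 R} phi).
Qed.

(** Monotone index maps send non-overlapping boxes to non-overlapping index
    boxes, so every sum is bounded by the one finite sum over all unit cells. *)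
Lemma vitali_variation_step_lty (R : realType) (r : nat)
    (kappa : {i01 R} -> nat) (F : ('I_r -> nat) -> R) :
    {homo kappa : x y / (x <= y)%O >-> (x <= y)%N} ->
  (vitali_variation (fun x => F (fun i => kappa (x i))) < +oo)%E.
Proof.
move=> kappa_homo.
apply: (@le_lt_trans _ _ (\sum_(k : {ffun 'I_r -> 'I_(kappa one01)})
  `|alt_sum F (fun i => k i) (fun i => (k i).+1)|)%:E); last exact: ltry.
apply: vitali_variation_le => n a b ab sep.
under eq_bigr do rewrite -[box_delta _ _ _](alt_sum_comp (fun=> kappa) F).
rewrite lee_fin; apply: sum_alt_sum_le_grid => [j i|j i|j j' /sep].
- exact/kappa_homo/ab.
- exact/kappa_homo/i01_le1.
- exact: (@nonoverlapping_homo _ _ _ {i01 R} nat (fun=> kappa)).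
Qed.

(** * Faces of the cube and the Hardy-Krause norm *)

Lemma increasing_ord_inj (r d : nat) (s : {ffun 'I_r -> 'I_d}) :
  increasing_ord s -> injective s.
Proof.
move=> /forallP s_inc i j sij; apply/val_inj/eqP/negPn/negP.
rewrite neq_ltn => /orP[] lt_ij.
  by have /forallP/(_ j)/implyP/(_ lt_ij) := s_inc i; rewrite sij ltnn.
by have /forallP/(_ i)/implyP/(_ lt_ij) := s_inc j; rewrite sij ltnn.
Qed.

(** An increasing enumeration is determined by its range, as a sorted sequence
    is determined by its elements. *)
Lemma increasing_ord_image_inj (r d : nat) (s s' : {ffun 'I_r -> 'I_d}) :
    increasing_ord s -> increasing_ord s' ->
  s @: finset.setT = s' @: finset.setT -> s = s'.
Proof.
have sorted_inc (q : {ffun 'I_r -> 'I_d}) :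
    increasing_ord q -> sorted ltn [seq val (q i) | i <- enum 'I_r].
  move=> /forallP q_inc; rewrite (map_comp val q) sorted_map.
  apply: (homo_sorted (e := relpre val ltn)).
    by move=> i j; have /forallP/(_ j)/implyP := q_inc i; exact.
  by rewrite -sorted_map val_enum_ord iota_ltn_sorted.
move=> s_inc s'_inc im; have : [seq val (s i) | i <- enum 'I_r] =
    [seq val (s' i) | i <- enum 'I_r].
  apply: (irr_sorted_eq ltn_trans ltnn) (sorted_inc _ s_inc) (sorted_inc _ s'_inc) _.
  have memE (q : {ffun 'I_r -> 'I_d}) (k : nat) :
      (k \in [seq val (q i) | i <- enum 'I_r]) = [exists v in q @: finset.setT, val v == k].
    apply/mapP/exists_inP => [[i _ ->]|[_ /imsetP[i _ ->] /eqP<-]].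
      by exists (q i); rewrite ?imset_f ?finset.inE.
    by exists i; rewrite ?mem_enum.
  by move=> k; rewrite !memE im.
move=> /eq_in_map ss'; apply/ffunP => i; apply/val_inj/ss'.
by rewrite mem_enum.
Qed.

(** The norm sums over increasing enumerations of coordinates, whereas
    inclusion-exclusion produces sets of coordinates. *)
Lemma sum_sets_of_card (R : nmodType) (r d : nat) (F : {set 'I_d} -> R) :
  \sum_(u : {set 'I_d} | #|u| == r) F u =
  \sum_(s : {ffun 'I_r -> 'I_d} | increasing_ord s) F (s @: finset.setT).
Proof.
pose inc := [set s : {ffun 'I_r -> 'I_d} | increasing_ord s]%SET.
transitivity (\sum_(u in [set s @: finset.setT | s : {ffun 'I_r -> 'I_d} in inc]%SET) F u).
  apply: eq_bigl => u; apply/eqP/imsetP => [ur|[s + ->]]; last first.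
    rewrite finset.inE => /increasing_ord_inj s_inj.
    by rewrite card_imset // cardsT card_ord.
  pose s i := enum_val (cast_ord (esym ur) i); exists (finfun s).
    rewrite finset.inE; apply/forallP => i; apply/forallP => j; apply/implyP => ij.
    rewrite !ffunE {1}/s /(s j).
    have lt_u (k : 'I_r) : (k < size (enum u))%N by rewrite -cardE ur.
    have u_sorted : sorted (relpre val ltn) (enum u).
      apply: (@subseq_sorted _ _ _ _ (enum 'I_d)); first by move=> ? ? ?; exact: ltn_trans.
        by rewrite [enum 'I_d]enumT; exact: filter_subseq.
      by rewrite -sorted_map val_enum_ord iota_ltn_sorted.
    rewrite (enum_val_nth (s i)) (enum_val_nth (s i) (cast_ord _ j)).
    apply: (sorted_ltn_nth _ _ u_sorted); rewrite ?inE //=.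
    by move=> ? ? ?; exact: ltn_trans.
  apply/finset.setP => v; apply/idP/imsetP => [vu|[i _ ->]].
    exists (cast_ord ur (enum_rank_in vu v)); rewrite ?finset.inE // ffunE.
    by rewrite /s cast_ordK enum_rankK_in.
  by rewrite ffunE enum_valP.
rewrite big_imset /= => [|s s']; first by apply: eq_bigl => s; rewrite finset.inE.
rewrite !finset.inE; exact: increasing_ord_image_inj.
Qed.

(** The sum is the expansion of the product of the factors -1 + [i \notin j],
    which vanishes as soon as some i lies outside [j]. *)
Lemma sum_supersets_sign (R : comPzRingType) (I : finType) (j : {set I}) :
  \sum_(u : {set I} | j \subset u) (-1) ^+ #|u| = 
  (-1) ^+ #|I| * (j == finset.setT)%:R :> R.
Proof.
transitivity (\prod_i (- 1 + (i \notin j)%:R) : R).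
  rewrite bigA_distr big_mkcond; apply: eq_bigr => u _.
  rewrite (bigID (mem u)) /=.
  under eq_bigr => i iu do rewrite iu.
  under [X in _ * X]eq_bigr => i iu do rewrite (negbTE iu).
  rewrite prodr_const; case: ifPn => [ju|/fintype.subsetPn[i ij iu]].
    rewrite [X in _ * X]big1 ?mulr1 // => i iu.
    by rewrite (contra _ iu) // => /(fintype.subsetP ju).
  by rewrite [X in _ * X](bigD1 i) //= ij mul0r mulr0.
case: eqP => [->|/eqP jT].
  by under eq_bigr do rewrite finset.inE addr0; rewrite prodr_const mulr1.
have /fintype.subsetPn[i _ ij] : ~~ (finset.setT \subset j) by rewrite finset.subTset.
by rewrite mulr0 (bigD1 i) //= ij addNr mul0r.
Qed.

Lemma signed_subset_sums_inversion (R : comPzRingType) (I : finType)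
    (H : {set I} -> R) :
  \sum_(u : {set I}) (-1) ^+ #|u| * (\sum_(j : {set I} | j \subset u) (-1) ^+ #|j| * H j)
  = H finset.setT.
Proof.
under eq_bigr do rewrite big_distrr /=.
rewrite (exchange_big_dep xpredT) //=.
under eq_bigr => j _ do rewrite -big_distrl /= sum_supersets_sign.
rewrite (bigD1 finset.setT) //= big1 ?addr0 => [|j /negbTE->].
  by rewrite eqxx mulr1 mulrA -exprD cardsT -signr_odd addnn odd_double mul1r.
by rewrite mulr0 mul0r.
Qed.

(** The corners of the box [x, 1] of a face are the points that agree with [x] on
    a subset of the coordinates of the face and equal 1 elsewhere. *)
Lemma box_delta_faceE (R : realType) (r d : nat) (h : cube R d -> R)
    (s : {ffun 'I_r -> 'I_d}) (x : cube R d) :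
    injective s ->
  box_delta (face h s) (fun l => x (s l)) (fun=> one01) =
  \sum_(j : {set 'I_d} | j \subset s @: finset.setT)
     (-1) ^+ #|j| * h (fun i => if i \in j then x i else one01).
Proof.
move=> s_inj.
rewrite (reindex_onto (fun j : {ffun 'I_r -> bool} => s @: [set l | j l]%SET)
  (fun j => [ffun l => s l \in j])) /= => [|j js]; last first.
  apply/finset.setP => i; apply/imsetP/idP => [[l + ->]|ij].
    by rewrite finset.inE ffunE.
  have /imsetP[l _ il] := fintype.subsetP js i ij.
  by exists l => //; rewrite finset.inE ffunE -il.
apply: eq_big => [j|j _].
  symmetry; apply/andP; split; first exact/imsetS/finset.subsetT.
  by apply/eqP/ffunP => l; rewrite ffunE mem_imset // finset.inE.
congr (_ ^+ _ * h _).
  rewrite card_imset // cardsE -sum1_card [RHS]big_mkcond; apply: eq_bigr => l _.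
  by rewrite -topredE /=; case: (j l).
apply/funext => i; case: pickP => [l /eqP <-|no_l].
  by rewrite mem_imset // finset.inE.
by case: imsetP => // -[l _ il]; have := no_l l; rewrite il eqxx.
Qed.

(** Inclusion-exclusion anchored at the corner (1, ..., 1): the sets of
    coordinates are grouped by cardinality, and the empty set yields the value at
    the corner. *)
Lemma face_expansion (R : realType) (d : nat) (h : cube R d -> R) (x : cube R d) :
  h x = h (fun=> one01) +
    \sum_(1 <= r < d.+1) \sum_(s : {ffun 'I_r -> 'I_d} | increasing_ord s)
      (-1) ^+ r * box_delta (face h s) (fun l => x (s l)) (fun=> one01).
Proof.
pose H (j : {set 'I_d}) := h (fun i => if i \in j then x i else one01).
have -> : h x = H finset.setT.
  by congr h; apply/funext => i; rewrite finset.inE.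
rewrite -signed_subset_sums_inversion.
have cardlt (u : {set 'I_d}) : (#|u| < d.+1)%N.
  by rewrite ltnS -[leqRHS]card_ord max_card.
rewrite (partition_big (fun u => Ordinal (cardlt u)) xpredT) //=.
rewrite -[RHS]/(_ + \sum_(1 <= r < d.+1) _) big_ord_recl /=; congr (_ + _).
  rewrite (big_pred1 finset.set0) => [|u]; last by rewrite /= -cards_eq0.
  rewrite cards0 mul1r (big_pred1 finset.set0) => [|u]; last by rewrite /= finset.subset0.
  by rewrite cards0 mul1r; congr h; apply/funext => i; rewrite finset.inE.
rewrite big_add1 big_mkord; apply: eq_bigr => r _.
transitivity (\sum_(u : {set 'I_d} | #|u| == r.+1)
    (-1) ^+ r.+1 * \sum_(j : {set 'I_d} | j \subset u) (-1) ^+ #|j| * H j).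
  by apply: eq_big => [u|u /eqP/(congr1 val)/= ->].
rewrite sum_sets_of_card; apply: eq_bigr => s /increasing_ord_inj s_inj.
by rewrite box_delta_faceE.
Qed.

(** Fixing 1 is what makes the composition commute with the restriction to the
    faces. *)
Lemma hk_norm_comp_le (R : realType) (d : nat) (phi : {i01 R} -> {i01 R})
    (h : cube R d -> R) :
    {homo phi : x y / (x <= y)%O} -> phi one01 = one01 ->
  (hk_norm (fun x => h (fun i => phi (x i))) <= hk_norm h)%E.
Proof.
move=> phi_homo phi1; rewrite /hk_norm.
apply: lee_sum => r _; apply: lee_sum => s _.
have -> : face (fun x => h (fun i => phi (x i))) s =
    fun y => face h s (fun i => phi (y i)).
  apply/funext => y; rewrite /face; congr h; apply/funext => j.
  by case: pickP => // _; exact: phi1.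
exact: (@vitali_variation_comp_le _ _ (fun=> phi)).
Qed.

(** Each face of a step function is a step function, since the step map fixes 1. *)
Lemma hk_norm_step_lty (R : realType) (d : nat) (kappa : {i01 R} -> nat)
    (p : nat -> {i01 R}) (g : cube R d -> R) :
    {homo kappa : x y / (x <= y)%O >-> (x <= y)%N} ->
    p (kappa one01) = one01 ->
    (forall x, g (fun i => p (kappa (x i))) = g x) ->
  (hk_norm g < +oo)%E.
Proof.
move=> kappa_homo p1 gp; rewrite /hk_norm.
apply: lte_sum_pinfty => r _; apply: lte_sum_pinfty => s _.
have -> : face g s = fun y => face g s (fun i => p (kappa (y i))).
  apply/funext => y; rewrite /face -gp; congr g; apply/funext => j.
  by case: pickP => // _; exact: p1.
exact: (vitali_variation_step_lty (fun k => face g s (fun i => p (k i)))).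
Qed.

Lemma vitali_face_le_hk_norm (R : realType) (d r : nat) (h : cube R d -> R)
    (s : {ffun 'I_r -> 'I_d}) :
    (1 <= r < d.+1)%N -> increasing_ord s ->
  (vitali_variation (face h s) <= hk_norm h)%E.
Proof.
move=> rd s_inc; rewrite /hk_norm (bigD1_seq r) ?mem_index_iota ?iota_uniq //=.
rewrite (bigD1 s) //= -addeA leeDl // adde_ge0 //.
  by apply: sume_ge0 => ? _; exact: vitali_variation_ge0.
by apply: sume_ge0 => ? _; apply: sume_ge0 => ? _; exact: vitali_variation_ge0.
Qed.

Lemma sup_norm_comp_le (R : realType) (d : nat) (h : cube R d -> R)
    (phi : cube R d -> cube R d) :
  (sup_norm (h \o phi) <= sup_norm h)%E.
Proof. by apply: le_ereal_sup => _ [x _ <-]; exists (phi x). Qed.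

(** * Linear spans *)

Lemma lin_span_lin (R : realType) (T : Type) (G : set (T -> R)) (a : R)
    (u v : T -> R) :
  lin_span G u -> lin_span G v -> lin_span G (a *: u + v).
Proof.
move=> [n [cu [fu [Gfu ->]]]] [m [cv [fv [Gfv ->]]]].
exists (n + m)%N, (fun i => match fintype.split i with inl j => a * cu j | inr j => cv j end),
  (fun i => match fintype.split i with inl j => fu j | inr j => fv j end).
split=> [i|]; first by case: (fintype.split i).
rewrite big_split_ord /= scaler_sumr; congr (_ + _); apply: eq_bigr => i _.
  by rewrite (unsplitK (inl i)) scalerA.
by rewrite (unsplitK (inr i)).
Qed.

Lemma lin_span0 (R : realType) (T : Type) (G : set (T -> R)) : lin_span G 0.
Proof. by exists 0%N, (fun=> 0), (fun=> 0); split=> [[]//|]; rewrite big_ord0. Qed.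

Lemma lin_span_gen (R : realType) (T : Type) (G : set (T -> R)) (f : T -> R) :
  G f -> lin_span G f.
Proof.
move=> Gf; exists 1%N, (fun=> 1), (fun=> f); split=> //.
by rewrite big_ord1 scale1r.
Qed.

Lemma lin_spanD (R : realType) (T : Type) (G : set (T -> R)) (u v : T -> R) :
  lin_span G u -> lin_span G v -> lin_span G (u + v).
Proof. by move=> Gu Gv; rewrite -[u]scale1r; exact: lin_span_lin. Qed.

Lemma lin_spanZ (R : realType) (T : Type) (G : set (T -> R)) (a : R) (u : T -> R) :
  lin_span G u -> lin_span G (a *: u).
Proof. by move=> Gu; rewrite -[_ *: _]addr0; apply: lin_span_lin => //; exact: lin_span0. Qed.

Lemma lin_span_sum (R : realType) (T : Type) (G : set (T -> R)) (I : Type)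
    (s : seq I) (P : pred I) (F : I -> T -> R) :
  (forall i, P i -> lin_span G (F i)) -> lin_span G (\sum_(i <- s | P i) F i).
Proof. by move=> GF; apply: big_ind => //; [exact: lin_span0|exact: lin_spanD]. Qed.

Section linear_on_span.
Variables (R : realType) (T : Type) (G : set (T -> R)) (Z : (T -> R) -> R).
Hypothesis Zlin : linear_on (lin_span G) Z.

Lemma linear_on_span0 : Z 0 = 0.
Proof.
have := Zlin 1 (@lin_span0 _ _ G) (@lin_span0 _ _ G).
by rewrite scale1r addr0 mul1r -[LHS]addr0 => /addrI.
Qed.

Lemma linear_on_spanZ a u : lin_span G u -> Z (a *: u) = a * Z u.
Proof.
move=> Gu; have := Zlin a Gu (@lin_span0 _ _ G).
by rewrite linear_on_span0 !addr0.
Qed.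

Lemma linear_on_spanD u v : lin_span G u -> lin_span G v -> Z (u + v) = Z u + Z v.
Proof. by move=> Gu Gv; have := Zlin 1 Gu Gv; rewrite scale1r mul1r. Qed.

Lemma linear_on_span_sum (I : Type) (s : seq I) (P : pred I) (F : I -> T -> R) :
    (forall i, P i -> lin_span G (F i)) ->
  Z (\sum_(i <- s | P i) F i) = \sum_(i <- s | P i) Z (F i).
Proof.
move=> GF; elim: s => [|i s IH]; first by rewrite !big_nil linear_on_span0.
rewrite !big_cons; case: ifP => // Pi.
by rewrite linear_on_spanD ?IH //; [exact: GF|exact: lin_span_sum].
Qed.

End linear_on_span.

(** * Indicators of products of anchored intervals *)

(** The intervals [0, q] and [0, q[ that contain 0. *)
Definition lower (R : realType) (A : set {i01 R}) : Prop :=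
  A zero01 /\ forall x y, (x <= y)%O -> A y -> A x.

Definition prod_indic (R : realType) (d : nat) (A : 'I_d -> set {i01 R}) :
    cube R d -> R :=
  \1_[set x | forall i, A i (x i)].

Lemma box0E (R : realType) (d : nat) (x : cube R d) :
  (\1_(box0 x) : cube R d -> R) = prod_indic (fun i => [set t | (t <= x i)%O]).
Proof.
congr \1__; apply/seteqP; split=> y xy i; have := xy i; rewrite /= in_itv /=.
  by move=> /andP[].
by move=> yx; rewrite ge0.
Qed.

Lemma prod_indicT (R : realType) (d : nat) (A : 'I_d -> set {i01 R}) (x : cube R d) :
  (forall i, A i (x i)) -> prod_indic A x = 1.
Proof. by move=> Ax; rewrite /prod_indic indicE mem_set. Qed.

Lemma prod_indicF (R : realType) (d : nat) (A : 'I_d -> set {i01 R}) (x : cube R d) :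
  ~ (forall i, A i (x i)) -> prod_indic A x = 0.
Proof. by move=> Ax; rewrite /prod_indic indicE memNset. Qed.

(** If [A] has no largest element, the points max 0 (sup A - 1/(k+1)) lie in [A]
    and exhaust it; otherwise its largest element does. *)
Lemma lower_cofinal (R : realType) (A : set {i01 R}) : lower A ->
  exists q : nat -> {i01 R},
    [/\ {homo q : k l / (k <= l)%N >-> (k <= l)%O}, forall k, A (q k) &
        forall x, A x -> exists k, (x <= q k)%O].
Proof.
move=> [A0 Ale].
have [[m Am mmax]|nomax] := pselect (exists2 m, A m & forall x, A x -> (x <= m)%O).
  by exists (fun=> m); split=> // x /mmax; exists 0%N.
pose S : set R := [set x%:num | x in A].
have S_sup : has_sup S.
  split; first by exists (zero01 : {i01 R})%:num, zero01.
  by exists 1 => _ [x _ <-]; exact: le1.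
have S0 : 0 <= sup S by apply: ub_le_sup; [exact: S_sup.2|exists zero01].
have S1 : sup S <= 1 by apply: ge_sup; [exact: S_sup.1|move=> _ [x _ <-]; exact: le1].
have q0 k : 0 <= Num.max 0 (sup S - k.+1%:R^-1) by rewrite le_max lexx.
have q1 k : Num.max 0 (sup S - k.+1%:R^-1) <= 1.
  by rewrite ge_max ler01 /= (le_trans _ S1) // gerBl.
pose q k : {i01 R} := Itv01 (q0 k) (q1 k).
exists q; split=> [k l kl|k|x Ax].
- rewrite -num_le /= ge_max !le_max lexx /= lerD2l lerN2 lef_pV2 ?posrE //.
  by rewrite ler_nat ltnS kl orbT.
- have [Sk|Sk] := leP (sup S - k.+1%:R^-1) 0.
    by apply: Ale A0; rewrite -num_le /= max_l.
  have k0 : 0 < k.+1%:R^-1 :> R by rewrite invr_gt0.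
  have [_ [y Ay <-] Sy] := sup_adherent k0 S_sup.
  by apply: Ale Ay; rewrite -num_le /= max_r // ltW.
- have [y Ay xy] : exists2 y, A y & (x < y)%O.
    apply: contrapT => noy; apply: nomax; exists x => // y Ay.
    by rewrite leNgt; apply/negP => xy; apply: noy; exists y.
  have Sx : 0 < sup S - x%:num.
    rewrite subr_gt0; apply: (@lt_le_trans _ _ y%:num); first by rewrite num_lt.
    by apply: ub_le_sup; [exact: S_sup.2|exists y].
  have [k xk] : exists k, k.+1%:R^-1 < sup S - x%:num.
    exists (Num.trunc (sup S - x%:num)^-1).
    by rewrite invf_plt ?posrE //; exact: truncnS_gt.
  by exists k; rewrite -num_le /= le_max lerBrDr -lerBrDl (ltW xk) orbT.
Qed.

(** The boxes [0, q_k], with q_k running in each coordinate through a cofinal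
    sequence of the factor, increase to the product. *)
Lemma prod_indic_closure (R : realType) (d : nat) (A : 'I_d -> set {i01 R}) :
    (forall i, lower (A i)) ->
  monotone_closure (@box_indicators R d) (prod_indic A).
Proof.
move=> A_lower.
have [q qP] := choice (fun i => lower_cofinal (A_lower i)).
pose f k := prod_indic (fun i => [set t | (t <= q i k)%O]).
exists f; split=> [k|x].
  by exists (fun i => q i k) => //; rewrite box0E.
have f_le k l : (k <= l)%N -> f k x <= f l x.
  move=> kl; have [fk|fk] := pselect (forall i, (x i <= q i k)%O).
    rewrite /f !prod_indicT // => i /=; apply: le_trans (fk i) _.
    by have [qi _ _] := qP i; exact: qi.
  by rewrite [f k x]prod_indicF // /f /prod_indic indicE ler0n.
split=> //; have [Ax|Ax] := pselect (forall i, A i (x i)).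
  have ex i : exists k, (x i <= q i k)%O by have [_ _] := qP i; exact.
  have [K KP] := choice ex.
  rewrite (prod_indicT Ax); apply: cvg_near_cst.
  exists (\max_i K i)%N => // k /= Kk; apply: prod_indicT => i /=.
  apply: le_trans (KP i) _; have [qi _ _] := qP i; apply: qi.
  by apply: leq_trans Kk; exact: leq_bigmax.
rewrite (prod_indicF Ax); apply: cvg_near_cst; near=> k.
apply: prod_indicF => /= xk; apply: Ax => i.
have [_ qA _] := qP i; exact: (A_lower i).2 _ _ (xk i) (qA k).
Unshelve. all: by end_near. Qed.

(** Indicators can only increase if the boxes do; the limit is the indicator of
    their union, which is again a product because the boxes form a chain. *)
Lemma closure_prod_indic (R : realType) (d : nat) (g : cube R d -> R) :
    monotone_closure (@box_indicators R d) g ->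
  exists A : 'I_d -> set {i01 R}, (forall i, lower (A i)) /\ g = prod_indic A.
Proof.
move=> [f [Ff fg]].
have ex k : exists x : cube R d, f k = prod_indic (fun i => [set t | (t <= x i)%O]).
  by have [x _ <-] := Ff k; exists x; rewrite box0E.
have [q qf] := choice ex.
have q_homo k l i : (k <= l)%N -> (q k i <= q l i)%O.
  move=> kl; have := (fg (q k)).1 k l kl; rewrite !qf prod_indicT => [|i0 /=]; last exact: lexx.
  have [//|nle] := pselect (forall i, (q k i <= q l i)%O).
  by rewrite prod_indicF ?ler10.
pose A i := [set t : {i01 R} | exists k, (t <= q k i)%O].
exists A; split=> [i|].
  split; first by exists 0%N; exact: i01_ge0.
  by move=> x y xy [k yk]; exists k; exact: le_trans yk.
apply/funext => x; rewrite -(cvg_lim (@Rhausdorff R) (fg x).2).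
apply: (cvg_lim (@Rhausdorff R)).
have [Ax|Ax] := pselect (forall i, exists k, (x i <= q k i)%O).
  have [K KP] := choice Ax.
  rewrite (prod_indicT Ax); apply: cvg_near_cst.
  exists (\max_i K i)%N => // k /= Kk; rewrite qf; apply: prod_indicT => i /=.
  by apply: le_trans (KP i) _; apply/q_homo/(leq_trans _ Kk)/leq_bigmax.
rewrite (prod_indicF Ax); apply: cvg_near_cst; near=> k.
by rewrite qf; apply: prod_indicF => /= xk; apply: Ax => i; exists k.
Unshelve. all: by end_near. Qed.

Lemma eq_of_leq_sum (I : finType) (F G : I -> nat) :
    (forall i, (F i <= G i)%N) -> (\sum_i F i = \sum_i G i)%N ->
  forall i, F i = G i.
Proof.
move=> FG eqFG i; apply/eqP; apply: contra_eqT eqFG => FGi.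
rewrite (bigD1 i) //= [X in _ != X](bigD1 i) //= neq_ltn; apply/orP; left.
have lt_i : (F i < G i)%N by rewrite ltn_neqAle FGi FG.
by rewrite -addSn leq_add // leq_sum.
Qed.

(** Count the anchored intervals, over all factors of all products occurring in
    [g], that do not contain [t].  As these intervals form a chain, the count
    determines which of them contain [t]. *)
Lemma span_step_index (R : realType) (d : nat) (g : cube R d -> R) :
    lin_span (monotone_closure (@box_indicators R d)) g ->
  exists kappa : {i01 R} -> nat,
    [/\ {homo kappa : x y / (x <= y)%O >-> (x <= y)%N}, kappa zero01 = 0%N &
        forall x y, (forall i, kappa (x i) = kappa (y i)) -> g x = g y].
Proof.
move=> [n [a [f [Gf ->]]]].
have [A AP] := choice (fun m => closure_prod_indic (Gf m)).
pose out (t : {i01 R}) (q : 'I_n * 'I_d) : nat := `[< ~ A q.1 q.2 t >].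
have out_homo t t' q : (t <= t')%O -> (out t q <= out t' q)%N.
  move=> tt'; rewrite /out; case: asboolP => //; case: asboolP => // At' /(_ _) [].
  have [_] := (AP q.1).1 q.2; apply; first exact: tt'.
  exact: contrapT.
have out_eq t t' : (\sum_q out t q = \sum_q out t' q)%N -> forall q, out t q = out t' q.
  wlog tt' : t t' / (t <= t')%O.
    by move=> W; case/orP: (le_total t t') => [/W//|/W W' /esym/W' E] q; rewrite E.
  by apply: eq_of_leq_sum => q; exact: out_homo.
exists (fun t => \sum_q out t q)%N; split=> [t t' tt'||x y xy].
- by apply: leq_sum => q _; exact: out_homo.
- rewrite big1 // => q _; rewrite /out asboolF //; apply.
  by have [] := (AP q.1).1 q.2.
rewrite !fct_sumE; apply: eq_bigr => m _; congr (_ *: _).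
have Axy i : A m i (x i) <-> A m i (y i).
  have := out_eq _ _ (xy i) (m, i); rewrite /out /=.
  by case: asboolP; case: asboolP => // /contrapT ? /contrapT ?.
rewrite (AP m).2.
have [Ax|Ax] := pselect (forall i, A m i (x i)).
  by rewrite !prod_indicT // => i; apply/Axy.
by rewrite !prod_indicF // => Ay; apply: Ax => i; apply/Axy.
Qed.

(** * Linear functionals on step functions *)

Lemma limit_le_ereal (R : realType) (u : nat -> R) (l : R) (z : \bar R) :
  (forall k, ((u k)%:E <= z)%E) -> u @ \oo --> l -> (l%:E <= z)%E.
Proof.
case: z => [z||] uz ul; [|exact: leey|by have := uz 0%N].
rewrite lee_fin -(cvg_lim (@Rhausdorff R) ul); apply: limr_le; first by apply/cvg_ex; exists l.
by apply: nearW => k; rewrite -lee_fin.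
Qed.

Lemma sup_dist_ge0 (R : realType) (d : nat) (X Y : (cube R d -> R) -> R) :
  (0 <= sup_dist (@box_indicators R d) X Y)%E.
Proof.
pose f : cube R d -> R := \1_(box0 (fun=> one01)).
apply: (@le_trans _ _ `|X f - Y f|%:E); first by rewrite lee_fin.
by apply: ereal_sup_ubound; exists f => //; exists (fun=> one01).
Qed.

(** The inequality defining the supremum passes to limits of increasing
    sequences. *)
Lemma closure_dist_le (R : realType) (T : Type) (F : set (T -> R))
    (X Y : (T -> R) -> R) (g : T -> R) :
    monotone_continuous F X -> monotone_continuous F Y ->
    monotone_closure F g ->
  (`|X g - Y g|%:E <= sup_dist F X Y)%E.
Proof.
move=> Xc Yc Gg; have [f [Ff fg]] := Gg.
apply: (@limit_le_ereal _ (fun k => `|X (f k) - Y (f k)|)) => [k|].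
  by apply: ereal_sup_ubound; exists (f k).
by apply: cvg_norm; apply: cvgB; [exact: Xc|exact: Yc].
Qed.

Section step_functions.
Variables (R : realType) (d : nat) (kappa : {i01 R} -> nat) (p : nat -> {i01 R}).
Hypothesis kappa_homo : {homo kappa : x y / (x <= y)%O >-> (x <= y)%N}.
Hypothesis kappa0 : kappa zero01 = 0%N.
Hypothesis p_homo : {homo p : i j / (i <= j)%N >-> (i <= j)%O}.
Hypothesis p1 : p (kappa one01) = one01.
Variable g : cube R d -> R.
Hypothesis g_step : forall x, g (fun i => p (kappa (x i))) = g x.

Let M := kappa one01.

(** The factor in coordinate [i] of the set of points [x] for which the cell of
    index [k] is contained in the box [x, 1] of the face [s]; in the coordinates
    outside the face there is no constraint. *)
Definition sublevel (r : nat) (s : {ffun 'I_r -> 'I_d}) (k : {ffun 'I_r -> 'I_M})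
    (i : 'I_d) : set {i01 R} :=
  [set t | forall l, s l = i -> (kappa t <= k l)%N].

Definition cell_delta (r : nat) (s : {ffun 'I_r -> 'I_d}) (k : {ffun 'I_r -> 'I_M}) : R :=
  (-1) ^+ r * box_delta (face g s) (fun l => p (k l)) (fun l => p (k l).+1).

Lemma sublevel_lower r s k i : lower (@sublevel r s k i).
Proof.
split=> [l _|x y xy ky l /ky]; first by rewrite kappa0.
exact/leq_trans/kappa_homo.
Qed.

(** In [face_expansion], the box [x, 1] of each face is subdivided into the cells
    of the grid of the points [p j]; the cell [k] occurs exactly when
    [kappa (x (s l)) <= k l] for all [l], which is the indicator of a product of
    anchored intervals. *)
Lemma step_expansion :
  g = g (fun=> one01) *: prod_indic (fun=> setT) +
    \sum_(1 <= r < d.+1) \sum_(s : {ffun 'I_r -> 'I_d} | increasing_ord s)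
      \sum_(k : {ffun 'I_r -> 'I_M}) cell_delta s k *: prod_indic (sublevel s k).
Proof.
apply/funext => x; rewrite -[LHS]g_step face_expansion.
rewrite [RHS]/= !fctE; congr (_ + _).
  by rewrite prod_indicT // [RHS]mulr1.
rewrite fct_sumE; apply: eq_bigr => r _.
rewrite fct_sumE; apply: eq_bigr => s _.
rewrite fct_sumE /=.
have -> : box_delta (face g s) (fun l => p (kappa (x (s l)))) (fun=> one01) =
    alt_sum (fun k => face g s (fun l => p (k l))) (fun l => kappa (x (s l))) (fun=> M).
  by rewrite -[RHS](alt_sum_comp (fun=> p)) p1.
rewrite (@alt_sum_grid _ _ M) => [|l|l]; [|exact/kappa_homo/i01_le1|exact: leqnn].
rewrite big_distrr big_mkcond /=; apply: eq_bigr => k _.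
rewrite fctE; case: forallP => xk.
  rewrite prod_indicT => [|i l <-]; last by have /andP[] := xk l.
  by rewrite [RHS]mulr1 /cell_delta -(alt_sum_comp (fun=> p)).
rewrite prod_indicF ?[RHS]mulr0 // => xk'; apply: xk => l.
by rewrite ltn_ord andbT; exact: xk'.
Qed.

Variables X Y : (cube R d -> R) -> R.
Hypothesis hXlin : linear_on (lin_span (monotone_closure (@box_indicators R d))) X.
Hypothesis hYlin : linear_on (lin_span (monotone_closure (@box_indicators R d))) Y.
Hypothesis hXmono : monotone_continuous (@box_indicators R d) X.
Hypothesis hYmono : monotone_continuous (@box_indicators R d) Y.
Hypothesis hXY1 : X (\1_[set: cube R d]) = Y (\1_[set: cube R d]).

(** X - Y vanishes on the constant term of [step_expansion] and is at most
    [sup_dist] on the other indicators, whose coefficients on a given face sum to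
    at most its Vitali variation. *)
Lemma step_dist_le :
  (`|X g - Y g|%:E <= hk_norm g * sup_dist (@box_indicators R d) X Y)%E.
Proof.
set D := sup_dist _ _ _; pose Z f := X f - Y f.
have Zlin : linear_on (lin_span (monotone_closure (@box_indicators R d))) Z.
  by move=> a u v Gu Gv; rewrite /Z hXlin // hYlin //; ring.
have ZD A : (forall i, lower (A i)) -> (`|Z (prod_indic A)|%:E <= D)%E.
  by move=> /prod_indic_closure; exact: closure_dist_le.
have Gk r s k : lin_span (monotone_closure (@box_indicators R d))
    (prod_indic (@sublevel r s k)).
  by apply/lin_span_gen/prod_indic_closure => i; exact: sublevel_lower.
have -> : X g - Y g = \sum_(1 <= r < d.+1)
    \sum_(s : {ffun 'I_r -> 'I_d} | increasing_ord s)
    \sum_(k : {ffun 'I_r -> 'I_M}) cell_delta s k * Z (prod_indic (sublevel s k)).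
  rewrite -/(Z g) [in LHS]step_expansion (linear_on_spanD Zlin); last 2 first.
  - by apply/lin_spanZ/lin_span_gen/prod_indic_closure.
  - by do 3! (apply: lin_span_sum => ? _); exact: lin_spanZ.
  rewrite (linear_on_spanZ Zlin); last by apply/lin_span_gen/prod_indic_closure.
  have -> : prod_indic (fun _ : 'I_d => [set: {i01 R}]) = \1_[set: cube R d].
    by congr \1__; apply/seteqP.
  rewrite /Z hXY1 subrr mulr0 add0r -/(Z _) (linear_on_span_sum Zlin) => [|r _]; last first.
    by do 2! (apply: lin_span_sum => ? _); exact: lin_spanZ.
  apply: eq_bigr => r _; rewrite (linear_on_span_sum Zlin) => [|s _]; last first.
    by apply: lin_span_sum => ? _; exact: lin_spanZ.
  apply: eq_bigr => s _; rewrite (linear_on_span_sum Zlin) => [|k _]; last exact: lin_spanZ.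
  by apply: eq_bigr => k _; rewrite (linear_on_spanZ Zlin).
have norm_sum (I : Type) (q : seq I) (P : pred I) (F : I -> R) :
    (`|\sum_(i <- q | P i) F i|%:E <= \sum_(i <- q | P i) `|F i|%:E)%E.
  by rewrite sumEFin lee_fin; exact: ler_norm_sum.
rewrite /hk_norm ge0_sume_distrl => [|r _]; last first.
  by apply: sume_ge0 => s _; exact: vitali_variation_ge0.
apply: le_trans (norm_sum _ _ _ _) _; apply: lee_sum => r _.
rewrite ge0_sume_distrl => [|s _]; last exact: vitali_variation_ge0.
apply: le_trans (norm_sum _ _ _ _) _; apply: lee_sum => s _.
apply: le_trans (norm_sum _ _ _ _) _.
apply: (@le_trans _ _ ((\sum_(k : {ffun 'I_r -> 'I_M}) `|cell_delta s k|)%:E * D)%E).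
  rewrite -sumEFin ge0_sume_distrl => [|k _]; last by rewrite lee_fin.
  apply: lee_sum => k _; rewrite normrM EFinM; apply: lee_wpmul2l.
    by rewrite lee_fin.
  by apply: ZD => i; exact: sublevel_lower.
apply: lee_wpmul2r; first exact: sup_dist_ge0.
under eq_bigr do rewrite normrM normrX normrN1 expr1n mul1r.
exact: monotone_grid_le_vitali.
Qed.

End step_functions.

(** * Uniform approximation by step functions *)

Definition clip (R : realType) (r : nat) (i : 'I_r) (t : {i01 R}) (l : 'I_r)
    (y : {i01 R}) : {i01 R} :=
  if l == i then Order.min y t else y.

(** The variation of [f] over the slab where coordinate [i] is at most [t].
    Truncating the coordinate, instead of restricting [f], keeps the whole cube as
    the domain. *)
Definition clip_variation (R : realType) (r : nat) (f : cube R r -> R) (i : 'I_r)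
    (t : {i01 R}) : \bar R :=
  vitali_variation (fun x => f (fun l => clip i t l (x l))).

Lemma clip_homo (R : realType) (r : nat) (i : 'I_r) (t : {i01 R}) (l : 'I_r) :
  {homo clip i t l : x y / (x <= y)%O}.
Proof.
move=> x y xy; rewrite /clip; case: eqP => // _.
by rewrite le_min !ge_min xy lexx orbT.
Qed.

Lemma clip_variation_le (R : realType) (r : nat) (f : cube R r -> R) i t :
  (clip_variation f i t <= vitali_variation f)%E.
Proof. by apply: vitali_variation_comp_le => l; exact: clip_homo. Qed.

Lemma clip_clip (R : realType) (r : nat) (i : 'I_r) (t t' : {i01 R}) l y :
  (t <= t')%O -> clip i t' l (clip i t l y) = clip i t l y.
Proof.
move=> tt'; rewrite /clip; case: eqP => // _.
by rewrite min_l // ge_min tt' orbT.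
Qed.

Lemma clip_variation_homo (R : realType) (r : nat) (f : cube R r -> R) i :
  {homo clip_variation f i : t t' / (t <= t')%O >-> (t <= t')%E}.
Proof.
move=> t t' tt'; rewrite /clip_variation.
have -> : (fun x : cube R r => f (fun l => clip i t l (x l))) =
    fun x => (fun y => f (fun l => clip i t' l (y l))) (fun l => clip i t l (x l)).
  by apply/funext => x; congr f; apply/funext => l; rewrite clip_clip.
by apply: (@vitali_variation_comp_le _ _ (clip i t)) => l; exact: clip_homo.
Qed.

(** The given box lies beyond the slab of height [a i], so it may be added to
    any non-overlapping family truncated at that height, and all these boxes lie
    in the slab of height [b i]. *)
Lemma clip_variation_increment (R : realType) (r : nat) (f : cube R r -> R) i
    (a b : cube R r) :
    (forall l, (a l <= b l)%O) ->
  (clip_variation f i (a i) + `|box_delta f a b|%:E <= clip_variation f i (b i))%E.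
Proof.
move=> ab; rewrite -leeBrDr //; apply: vitali_variation_le => n A B AB sep.
rewrite leeBrDr // -EFinD.
(* The family is indexed by a sum type: [inl tt] is the additional box. *)
pose f' x := f (fun l => clip i (b i) l (x l)).
pose A' (j : unit + 'I_n) := if j is inr m then fun l => clip i (a i) l (A m l) else a.
pose B' (j : unit + 'I_n) := if j is inr m then fun l => clip i (a i) l (B m l) else b.
have -> : \sum_j `|box_delta (fun x => f (fun l => clip i (a i) l (x l))) (A j) (B j)| +
    `|box_delta f a b| = \sum_(j : unit + 'I_n) `|box_delta f' (A' j) (B' j)|.
  rewrite big_sumType (big_pred1 tt) => [|[]//]; rewrite addrC /=; congr (`|_| + _).
    rewrite -[RHS](alt_sum_comp (clip i (b i))) /clip.
    by congr box_delta; apply/funext => l; case: eqP => // ->; rewrite min_l.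
  apply: eq_bigr => j _; congr `|_|.
  rewrite -[LHS](alt_sum_comp (clip i (a i))) -[RHS](alt_sum_comp (clip i (b i))).
  by congr alt_sum; apply/funext => l; rewrite clip_clip.
apply: nonoverlapping_sum_le_vitali => [[[]|j] l|[[]|j] [[]|j']] //=.
- exact: clip_homo.
- by move=> _; apply/existsP; exists i; rewrite /= /clip eqxx !ge_min lexx !orbT.
- by move=> _; apply/existsP; exists i; rewrite /= /clip eqxx !ge_min lexx !orbT.
- move=> jj'; apply: (@nonoverlapping_homo _ _ _ {i01 R} {i01 R} (clip i (a i))).
    by move=> l; exact: clip_homo.
  by apply: sep; apply: contraNN jj' => /eqP->.
Qed.

Lemma vitali_fin_num (R : realType) (r : nat) (f : cube R r -> R) :
  (vitali_variation f < +oo)%E -> vitali_variation f \is a fin_num.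
Proof. by move=> f_fin; rewrite ge0_fin_numE // vitali_variation_ge0. Qed.

Lemma le_fine_increment (R : realType) (u v : \bar R) (r : R) :
    u \is a fin_num -> v \is a fin_num ->
  (u + r%:E <= v)%E -> r <= fine v - fine u.
Proof. by move: u v => [u||] [v||] // _ _; rewrite -EFinD lee_fin lerBrDl. Qed.

Section uniform_approximation.
Variables (R : realType) (d : nat) (h : cube R d -> R).
Hypothesis h_fin : (hk_norm h < +oo)%E.

(** A single monotone function that controls the oscillation of [h] in each
    coordinate, so that one step map serves all coordinates. *)
Definition slab_variation (t : {i01 R}) : R :=
  \sum_(1 <= r < d.+1) \sum_(s : {ffun 'I_r -> 'I_d} | increasing_ord s)
    \sum_(l < r) fine (clip_variation (face h s) l t).

Lemma clip_variation_fin r (s : {ffun 'I_r -> 'I_d}) l t :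
  (1 <= r < d.+1)%N -> increasing_ord s -> clip_variation (face h s) l t \is a fin_num.
Proof.
move=> rd s_inc; apply: vitali_fin_num; apply: le_lt_trans h_fin.
by apply: le_trans (vitali_face_le_hk_norm h rd s_inc); exact: clip_variation_le.
Qed.

Lemma slab_variation_homo : {homo slab_variation : t t' / (t <= t')%O >-> (t <= t')}.
Proof.
move=> t t' tt'; apply: ler_sum_nat => r rd; apply: ler_sum => s s_inc; apply: ler_sum => l _.
apply: fine_le; [exact: clip_variation_fin|exact: clip_variation_fin|].
exact: clip_variation_homo.
Qed.

(** Expand both values by [face_expansion].  Only the faces containing direction
    [i] contribute to the difference, and on such a face the two boxes differ by a
    box whose side in that direction runs from [x i] to [c]. *)
Lemma update_dist_le_lt (x : cube R d) i c : (x i <= c)%O ->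
  `|h x - h (update x i c)| <= slab_variation c - slab_variation (x i).
Proof.
move=> xc; set y := update x i c; rewrite [h x]face_expansion [h y]face_expansion.
rewrite opprD addrACA subrr add0r /slab_variation -sumrB -[leRHS]sumrB.
apply: le_trans (ler_norm_sum _ _ _) _; apply: ler_sum_nat => r rd.
rewrite -sumrB -[leRHS]sumrB; apply: le_trans (ler_norm_sum _ _ _) _; apply: ler_sum => s s_inc.
rewrite -mulrBr normrM normrX normrN1 expr1n mul1r -[leRHS]sumrB.
have incr_ge0 l : 0 <= fine (clip_variation (face h s) l c) -
    fine (clip_variation (face h s) l (x i)).
  rewrite subr_ge0; apply: fine_le; [exact: clip_variation_fin..|].
  exact: clip_variation_homo.
have [l /eqP sl|no_l] := pickP (fun l => s l == i); last first.
  have -> : (fun l => y (s l)) = fun l => x (s l).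
    by apply/funext => l; rewrite /y /update no_l.
  by rewrite subrr normr0; apply: sumr_ge0 => l _.
rewrite (bigD1 l) //=; apply: (@le_trans _ _ (fine (clip_variation (face h s) l c) -
    fine (clip_variation (face h s) l (x i)))); last by rewrite lerDl sumr_ge0.
have -> : (fun l => y (s l)) = update (fun l => x (s l)) l c.
  apply/funext => m; rewrite /y /update -sl; congr (if _ then _ else _).
  exact/inj_eq/increasing_ord_inj.
rewrite [box_delta _ _ _](alt_sum_split _ _ _ l c) addrK.
have fin t : clip_variation (face h s) l t \is a fin_num by exact: clip_variation_fin.
apply: le_fine_increment => //; rewrite -{1}sl.
have upd_l : update (fun=> one01) l c l = c by rewrite /update eqxx.
rewrite -[X in (_ <= clip_variation _ _ X)%E]upd_l.
apply: (@clip_variation_increment _ _ _ l (fun m => x (s m))) => m.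
by rewrite /update; case: eqP => [->|_]; [rewrite sl|exact: i01_le1].
Qed.

(** The case [c <= x i] follows by exchanging the two points. *)
Lemma update_dist_le (x : cube R d) i c :
  `|h x - h (update x i c)| <= `|slab_variation (x i) - slab_variation c|.
Proof.
have [xc|/ltW cx] := leP (x i) c.
  by apply: le_trans (update_dist_le_lt xc) _; rewrite distrC ler_norm.
have -> : h x = h (update (update x i c) i (x i)).
  by congr h; apply/funext => j; rewrite /update; case: eqP => // ->.
have upd_i : update x i c i = c by rewrite /update eqxx.
have := @update_dist_le_lt (update x i c) i (x i); rewrite upd_i => /(_ cx) W.
by rewrite distrC (le_trans W) // ler_norm.
Qed.

(** Change the coordinates one at a time. *)
Lemma dist_le (x y : cube R d) (e : R) :
    (forall i, `|slab_variation (x i) - slab_variation (y i)| <= e) ->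
  `|h x - h y| <= d%:R * e.
Proof.
(* [z k] interpolates from [x], for [k = 0], to [y], for [k = d]. *)
move=> xy; pose z k : cube R d := fun i => if (i < k)%N then y i else x i.
have -> : h x - h y = \sum_(k < d) (h (z k) - h (z k.+1)).
  rewrite -(big_mkord xpredT (fun k => h (z k) - h (z k.+1))).
  under eq_bigr do rewrite -opprB.
  rewrite sumrN telescope_sumr // opprB; congr (h _ - h _); apply/funext => i.
  by rewrite /z ltn_ord.
apply: le_trans (ler_norm_sum _ _ _) _.
rewrite mulr_natl -[X in _ *+ X](card_ord d) -sumr_const; apply: ler_sum => k _.
have -> : z k.+1 = update (z k) k (y k).
  apply/funext => i; rewrite /z /update ltnS leq_eqVlt val_eqE.
  by case: (i =P k) => [->|].
apply: le_trans (update_dist_le _ _ _) _.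
by rewrite {1}/z ltnn; exact: xy.
Qed.

End uniform_approximation.

(** The index is the level of the slab variation at scale 1/(n+1). *)
Lemma hk_step_approximation (R : realType) (d : nat) (h : cube R d -> R) (n : nat) :
    (hk_norm h < +oo)%E ->
  exists (kappa : {i01 R} -> nat) (p : nat -> {i01 R}),
    [/\ [/\ {homo kappa : x y / (x <= y)%O >-> (x <= y)%N}, kappa zero01 = 0%N,
            {homo p : i j / (i <= j)%N >-> (i <= j)%O}, p (kappa one01) = one01 &
            forall t, kappa (p (kappa t)) = kappa t] &
        forall x, `|h x - h (fun i => p (kappa (x i)))| <= d%:R / n.+1%:R].
Proof.
move=> h_fin; have e0 : 0 < n.+1%:R^-1 :> R by rewrite invr_gt0.
have w_homo := slab_variation_homo h_fin.
pose kappa := level (slab_variation h) n.+1%:R^-1.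
have kappa_homo : {homo kappa : x y / (x <= y)%O >-> (x <= y)%N}.
  exact: level_homo w_homo e0.
have kappa0 : kappa zero01 = 0%N by exact: level_zero.
have [p [p_homo p1 pK]] := step_points kappa_homo kappa0.
exists kappa, p; split=> // x; apply: dist_le => // i.
exact: (level_dist w_homo e0 (esym (pK (x i)))).
Qed.

Lemma uniform_cvg_of_bound (R : realType) (d : nat) (h_ : nat -> cube R d -> R)
    (h : cube R d -> R) (c : R) :
    (forall n x, `|h x - h_ n x| <= c / n.+1%:R) ->
  {uniform, h_ @ \oo --> h}.
Proof.
move=> h_le P /uniform_nbhs[E [entE EP]].
move: entE; rewrite -entourage_ballE => -[e /= e0 eE].
exists (Num.trunc (c / e)) => // n /= nN; apply: EP => x _; apply: eE => /=.
rewrite /ball /=; apply: le_lt_trans (h_le n x) _.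
rewrite ltr_pdivrMr // mulrC -ltr_pdivrMr //.
apply: (lt_le_trans (truncnS_gt _)); by rewrite ler_nat ltnS.
Qed.

(** * The inequality on the span and on the Hardy-Krause class *)

Theorem theorem3p3 (R : realType) (d : nat) (X Y : (cube R d -> R) -> R)
  (hXlin : linear_on (lin_span (monotone_closure (@box_indicators R d))) X)
  (hYlin : linear_on (lin_span (monotone_closure (@box_indicators R d))) Y)
  (hXmono : monotone_continuous (@box_indicators R d) X)
  (hYmono : monotone_continuous (@box_indicators R d) Y)
  (hXY1 : X (\1_[set: cube R d]) = Y (\1_[set: cube R d])) :
  (forall g : cube R d -> R,
     lin_span (monotone_closure (@box_indicators R d)) g ->
     (hk_norm g < +oo)%E /\
     (`|X g - Y g|%:E <= hk_norm g * sup_dist (@box_indicators R d) X Y)%E) /\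
  (forall c : R, 0 < c ->
     continuous_wrt_uniform (@hk_class R d c) X ->
     continuous_wrt_uniform (@hk_class R d c) Y ->
     forall h : cube R d -> R, hk_class c h ->
       (`|X h - Y h|%:E <= hk_norm h * sup_dist (@box_indicators R d) X Y)%E).
Proof.
split=> [g /span_step_index[kappa [kappa_homo kappa0 g_kappa]]|].
  have [p [p_homo p1 pK]] := step_points kappa_homo kappa0.
  have g_step x : g (fun i => p (kappa (x i))) = g x.
    by apply: g_kappa => i; exact: pK.
  split; first exact: hk_norm_step_lty kappa_homo p1 g_step.
  exact: (step_dist_le kappa_homo kappa0 p_homo p1 g_step).
move=> c c0 Xc Yc h [hc hsup].
have h_fin : (hk_norm h < +oo)%E by apply: lt_trans hc _; exact: ltry.
have [kappa kappaP] := choice (fun n => hk_step_approximation n h_fin).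
have [p kpP] := choice kappaP => {kappaP}.
pose h_ n x := h (fun i => p n (kappa n (x i))).
have hk_h_ n : (hk_norm (h_ n) <= hk_norm h)%E.
  have [[kappa_homo _ p_homo p1 _] _] := kpP n.
  apply: (@hk_norm_comp_le _ _ (fun t => p n (kappa n t))) => // t t' /kappa_homo.
  exact: p_homo.
have Fh_ n : hk_class c (h_ n).
  split; first exact: le_lt_trans (hk_h_ n) hc.
  exact: le_trans (sup_norm_comp_le h (fun x i => p n (kappa n (x i)))) hsup.
have h_cvg : {uniform, h_ @ \oo --> h}.
  by apply: (@uniform_cvg_of_bound _ _ _ _ d%:R) => n x; have [_] := kpP n; exact.
apply: (@limit_le_ereal _ (fun n => `|X (h_ n) - Y (h_ n)|)) => [n|]; last first.
  by apply: cvg_norm; apply: cvgB; [exact: Xc h_cvg|exact: Yc h_cvg].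
have [[kappa_homo kappa0 p_homo p1 pK] _] := kpP n.
apply: (@le_trans _ _ (hk_norm (h_ n) * sup_dist (@box_indicators R d) X Y)%E).
  apply: (step_dist_le kappa_homo kappa0 p_homo p1) => // x.
  by rewrite /h_; congr h; apply/funext => i; rewrite pK.
by apply: lee_wpmul2r => //; exact: sup_dist_ge0.
Qed.
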